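(* Let $m\ge 2$ be an integer, $\xi=1/m$, $T>0$, and let $\beta_0,\beta_1\ge0$ be real numbers with $(\beta_0,\beta_1)\ne(0,0)$. Let $M\in\mathbb{R}^{m\times m}$, $\gamma$, $\lambda_k$ and $v^{[k]}$ ($k=1,\ldots,m$) be as defined in the context, let $e_m\in\mathbb{R}^m$ be the $m$-th unit vector, let $u(t)$, $t\in[0,T]$, and $\Psi(x)$, $x\in[0,1]$, be given real-valued functions, and let $\psi=(\Psi(x_j))_{j=1}^m\in\mathbb{R}^m$ with $x_j=(j-\frac12)\xi$. Then the solution of the initial value problem $$y'(t)=My(t)+\gamma e_m u(t),\qquad y(0)=\psi,$$ is given by $$y(t)=\sum_{k=1}^m\left(e^{\lambda_k t}\,(v^{[k]})^{\mathsf T}\psi+\gamma\, v^{[k]}_m\int_0^t e^{\lambda_k(t-\tau)}u(\tau)\,d\tau\right)v^{[k]}.$$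
   Context: Put $\theta=\dfrac{2\beta_1+3\beta_0\xi}{2\beta_1+\beta_0\xi}$ and $\gamma=\dfrac{2}{(2\beta_1+\beta_0\xi)\xi}$. The matrix $M\in\mathbb{R}^{m\times m}$ is symmetric tridiagonal: $\xi^2M$ has diagonal $(-1,-2,\ldots,-2,-\theta)$ (for $m=2$: $(-1,-\theta)$), all entries on the first sub- and superdiagonal equal to $1$, and all other entries zero. The eigenvalues of $M$ are $\lambda_k=-4m^2\sin^2\left(\frac{\omega_k}{2m}\right)$, $k=1,\ldots,m$, where $\omega_k$, $k=1,\ldots,m$, are the $m$ first non-negative solutions of $\tan(\omega)\tan\left(\frac{\omega}{2m}\right)=\frac{\beta_0}{2m\beta_1}$, with the convention $\omega_k=(k-\frac12)\pi$, $k=1,\ldots,m$, for $\beta_1=0$. The corresponding normalized eigenvectors $v^{[k]}\in\mathbb{R}^m$ have the components $$v^{[k]}_j=\nu_k\cos\left(\omega_k\frac{2j-1}{2m}\right),\ j=1,\ldots,m,\qquad \nu_k=\frac{2}{\sqrt{2m+\sin(2\omega_k)/\sin(\omega_k/m)}},$$ and $v^{[k]}_m$ denotes the last component of $v^{[k]}$. *)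

(* Defs.v *)
From mathcomp Require Export all_boot all_order all_algebra.
From mathcomp Require Export all_classical all_reals all_analysis.
Export Order.TTheory GRing.Theory Num.Theory numFieldNormedType.Exports.

Set Implicit Arguments.
Unset Strict Implicit.
Unset Printing Implicit Defensive.

Local Open Scope classical_set_scope.
Local Open Scope ring_scope.

(* Matrix and vector indices, and k, run over 'I_m and are thus 0-based: the
   mathematical index j = 1..m is i.+1 for i : 'I_m. *)

Section Discretization.
Context {R : realType} (m : nat) (beta0 beta1 : R).

Definition xi : R := m%:R^-1.

Definition theta : R :=
  (2 * beta1 + 3 * beta0 * xi) / (2 * beta1 + beta0 * xi).

Definition gamma : R := 2 / ((2 * beta1 + beta0 * xi) * xi).

Definition Mmat : 'M[R]_m := xi ^- 2 *:
  \matrix_(i, j)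
    if i == j then
      if i == 0%N :> nat then -1
      else if i.+1 == m then - theta else -2
    else if (i.+1 == j :> nat) || (j.+1 == i :> nat) then 1 else 0.

Definition em : 'cV[R]_m := \col_i (i.+1 == m)%:R.

Definition psi (Psi : R -> R) : 'cV[R]_m :=
  \col_i Psi ((i.+1%:R - 2^-1) * xi).

(* [tan] is total with value 0 at its poles, so the poles have to be excluded:
   for beta0 = 0 they would otherwise count as solutions. *)
Definition omega_solution (w : R) : Prop :=
  [/\ cos w != 0, cos (w / (2 * m%:R)) != 0
    & tan w * tan (w / (2 * m%:R)) = beta0 / (2 * m%:R * beta1)].

Definition first_nonneg_solutions (w : 'I_m -> R) : Prop :=
  [/\ forall i j : 'I_m, (i < j)%N -> w i < w j,
      forall i, 0 <= w i /\ omega_solution (w i)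
    & forall s, 0 <= s -> omega_solution s ->
        (exists i, s = w i) \/ (forall i, w i < s)].

(* The m first non-negative solutions are uniquely determined, so that [get],
   which picks an element of a set, denotes "the" increasing list of them. *)
Definition omega : 'I_m -> R :=
  if beta1 == 0 then fun k : 'I_m => (k.+1%:R - 2^-1) * pi
  else get [set w | first_nonneg_solutions w].

Definition lambda (k : 'I_m) : R :=
  - (4 * m%:R ^+ 2 * sin (omega k / (2 * m%:R)) ^+ 2).

(* sin (2 w) / sin (w / m), with its limit value 2 m at w = 0; the value
   w = 0 does occur, as the first frequency when beta0 = 0. *)
Definition sin_ratio (w : R) : R :=
  if w == 0 then 2 * m%:R else sin (2 * w) / sin (w / m%:R).

Definition nu (k : 'I_m) : R :=
  2 / Num.sqrt (2 * m%:R + sin_ratio (omega k)).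

(* Here j is the 1-based index; the last component is [vcomp k m]. *)
Definition vcomp (k : 'I_m) (j : nat) : R :=
  nu k * cos (omega k * ((2 * j%:R - 1) / (2 * m%:R))).

Definition v (k : 'I_m) : 'cV[R]_m := \col_i vcomp k i.+1.

End Discretization.

Section InitialValueProblem.
Context {R : realType}.

(* Derivative of f at t relative to D: two-sided at interior points of D,
   one-sided at the end points of an interval. *)
Definition has_derivative_within (D : set R) (f : R -> R) (t l : R) : Prop :=
  (f s - f t) / (s - t) @[s --> within D t^'] --> l.

Definition absolutely_continuous (a b : R) (f : R -> R) : Prop :=
  forall e : R, 0 < e -> exists2 d : R, 0 < d &
    forall (n : nat) (l r : 'I_n -> R),
      (forall i, [/\ a <= l i, l i <= r i & r i <= b]) ->
      trivIset [set: 'I_n] (fun i => `]l i, r i[%classic) ->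
      \sum_(i < n) (r i - l i) < d ->
      \sum_(i < n) `|f (r i) - f (l i)| < e.

Context (m : nat) (T : R) (A : 'M[R]_m) (f : R -> 'cV[R]_m) (y0 : 'cV[R]_m).

Definition ode_at (y : R -> 'cV[R]_m) (t : R) : Prop :=
  forall i : 'I_m, has_derivative_within `[0, T]
    (fun s => y s i ord0) t ((A *m y t + f t) i ord0).

(* y' = A y + f, y(0) = y0 on [0, T] everywhere. *)
Definition classical_solution (y : R -> 'cV[R]_m) : Prop :=
  y 0 = y0 /\ forall t, 0 <= t <= T -> ode_at y t.

(* y' = A y + f, y(0) = y0 on [0, T] in the sense of Caratheodory, the usual
   notion for a merely integrable f. *)
Definition caratheodory_solution (y : R -> 'cV[R]_m) : Prop :=
  [/\ y 0 = y0,
      forall i : 'I_m, absolutely_continuous 0 T (fun t => y t i ord0)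
    & {ae (@lebesgue_measure R), forall t, 0 <= t <= T -> ode_at y t}].

End InitialValueProblem.

(* Main.v *)
(* The vectors v^[k] are eigenvectors of the symmetric matrix M: inside the grid
   this is the addition theorem for the cosine, at the left end it is the
   evenness of the cosine, and at the right end it is the equation that defines
   the frequencies. There are m frequencies, one in each [k pi, k pi + pi/2[, by
   the intermediate value theorem and the monotonicity of tan; they give distinct
   eigenvalues, so the v^[k] form an orthonormal basis, and in the coordinates
   v^[k]^T y the system decouples into scalar equations z' = a z + c u. For
   these Duhamel's formula gives a solution by the Lebesgue differentiation
   theorem (or directly, if u is continuous). Conversely, for a solution z the
   function e^(- a t) z(t) - c int_0^t e^(- a s) u(s) ds is absolutely continuous
   with zero derivative almost everywhere, hence constant. *)

Require Import Defs.
From mathcomp Require Import all_boot all_order all_algebra.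
From mathcomp Require Import all_classical all_reals all_analysis.
From mathcomp Require Import measurable_realfun ring lra.
Import Order.TTheory GRing.Theory Num.Theory numFieldNormedType.Exports.
Local Open Scope classical_set_scope.
Local Open Scope ring_scope.

Set Implicit Arguments.
Unset Strict Implicit.

(** * Derivatives relative to a set *)

Section WithinDerivative.
Context {R : realType}.
Implicit Types (D : set R) (f g : R -> R) (t l : R).

(** Clearing the denominator makes the condition meaningful, and trivially true, at s = t, so later
    estimates need neither division nor a punctured neighbourhood. *)
Lemma has_derivative_withinP D f t l :
  has_derivative_within D f t l <->
  forall e, 0 < e -> exists2 d, 0 < d & forall s, D s -> `|s - t| < d ->
    `|f s - f t - l * (s - t)| <= e * `|s - t|.
Proof.
split=> [/cvgrPdist_le fl e e0|fl].
- have /nbhs_ballP[d /= d0 Bd] := fl _ e0.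
  exists d => // s Ds sd; have [->|st] := eqVneq s t.
    by rewrite !subrr mulr0 subr0 normr0 mulr0.
  have st0 : s - t != 0 by rewrite subr_eq0.
  have := Bd s; rewrite /ball/= distrC => /(_ sd st Ds) /= H.
  have -> : f s - f t - l * (s - t) = ((f s - f t) / (s - t) - l) * (s - t).
    by rewrite mulrBl mulfVK.
  by rewrite normrM distrC ler_wpM2r.
- apply/cvgrPdist_le => /= e e0; have [d d0 Hd] := fl _ e0.
  apply/nbhs_ballP; exists d => //= s; rewrite /ball/= distrC => sd st Ds.
  have st0 : s - t != 0 by rewrite subr_eq0.
  have := Hd s Ds sd.
  have -> : f s - f t - l * (s - t) = ((f s - f t) / (s - t) - l) * (s - t).
    by rewrite mulrBl mulfVK.
  by rewrite normrM distrC ler_pM2r// normr_gt0.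
Qed.

Lemma has_derivative_within_eq D f g t l : D t -> (forall s, D s -> f s = g s) ->
  has_derivative_within D f t l -> has_derivative_within D g t l.
Proof.
move=> Dt fg /has_derivative_withinP fl; apply/has_derivative_withinP => e /fl[d d0 Hd].
by exists d => // s Ds sd; rewrite -!fg//; exact: Hd.
Qed.

Lemma has_derivative_withinD D f g t l k :
  has_derivative_within D f t l -> has_derivative_within D g t k ->
  has_derivative_within D (fun s => f s + g s) t (l + k).
Proof.
move=> fl gk; rewrite /has_derivative_within.
rewrite (_ : (fun s => _) = fun s => (f s - f t) / (s - t) + (g s - g t) / (s - t)).
  exact: cvgD.
by apply/funext => s; rewrite -mulrDl; congr (_ / _); ring.
Qed.

Lemma has_derivative_withinZ D f t l (a : R) :
  has_derivative_within D f t l ->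
  has_derivative_within D (fun s => a * f s) t (a * l).
Proof.
move=> fl; rewrite /has_derivative_within.
rewrite (_ : (fun s => _) = fun s => a * ((f s - f t) / (s - t))).
  exact: cvgMr.
by apply/funext => s; rewrite mulrA mulrBr.
Qed.

Lemma has_derivative_within_cst D t (a : R) : has_derivative_within D (fun=> a) t 0.
Proof.
rewrite /has_derivative_within (_ : (fun s => _) = fun=> 0); first exact: cvg_cst.
by apply/funext => s; rewrite subrr mul0r.
Qed.

Lemma has_derivative_within_sum D t (n : nat) (a l : 'I_n -> R) (f : 'I_n -> R -> R) :
  (forall i, has_derivative_within D (f i) t (l i)) ->
  has_derivative_within D (fun s => \sum_i a i * f i s) t (\sum_i a i * l i).
Proof.
elim: n a l f => [|n IH] a l f fl.
  rewrite big_ord0; under [X in has_derivative_within _ X]eq_fun do rewrite big_ord0.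
  exact: has_derivative_within_cst.
rewrite big_ord_recl.
under [X in has_derivative_within _ X]eq_fun do rewrite big_ord_recl.
by apply: has_derivative_withinD; [exact: has_derivative_withinZ|apply: IH].
Qed.

Lemma has_derivative_within_continuous D f t l : has_derivative_within D f t l ->
  forall e, 0 < e -> exists2 d, 0 < d & forall s, D s -> `|s - t| < d ->
    `|f s - f t| <= e.
Proof.
move=> /has_derivative_withinP/(_ _ ltr01)[d d0 Hd] e e0.
have l1 : 0 < 1 + `|l| by rewrite ltr_pwDl.
(* With error factor 1 the increment of f is at most (1 + |l|) |s - t|, which dictates the second
   bound. *)
exists (Num.min d (e / (1 + `|l|))); first by rewrite lt_min d0 divr_gt0.
move=> s Ds; rewrite lt_min => /andP[sd se].
have -> : f s - f t = (f s - f t - l * (s - t)) + l * (s - t) by ring.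
rewrite (le_trans (ler_normD _ _))//.
rewrite (le_trans (lerD (Hd s Ds sd) (lexx _)))// normrM -mulrDl mulrC.
by rewrite -ler_pdivlMr// ltW.
Qed.

Lemma has_derivative_withinM D f g t l k :
  has_derivative_within D f t l -> has_derivative_within D g t k ->
  has_derivative_within D (fun s => f s * g s) t (f t * k + l * g t).
Proof.
move=> fl gk; rewrite /has_derivative_within.
rewrite (_ : (fun s => _) =
  fun s => f s * ((g s - g t) / (s - t)) + (f s - f t) / (s - t) * g t); last first.
  by apply/funext => s; ring.
apply: cvgD; last exact: cvgMl.
apply: cvgM => //; apply/cvgrPdist_le => e e0.
have [d d0 Hd] := has_derivative_within_continuous fl e0.
apply/nbhs_ballP; exists d => //= s; rewrite /ball/= distrC => sd _ Ds.
by rewrite distrC; exact: Hd.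
Qed.

Lemma is_derive_has_derivative_within D f t l :
  is_derive t 1 f l -> has_derivative_within D f t l.
Proof.
move=> fl; apply/has_derivative_withinP => e e0.
have : h^-1 *: (f (h + t) - f t) @[h --> 0^'] --> l.
  have [/cvg_ex[k fk] dl] := fl; rewrite /derive in dl.
  have kl : k = l by rewrite -dl; apply/esym/cvg_lim.
  rewrite -kl; move: fk; set F := (F in F @ _ --> _ -> _).
  rewrite (_ : F = fun h => h^-1 *: (f (h + t) - f t))//.
  by apply/funext => h; rewrite /F /= [X in f (X + _)]mulr1.
move=> /cvgrPdist_le/(_ _ e0)/nbhs_ballP[d /= d0 Bd]; exists d => // s _ sd.
have [->|st] := eqVneq s t.
  by rewrite !subrr mulr0 subr0 normr0 mulr0.
have st0 : s - t != 0 by rewrite subr_eq0.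
have := Bd (s - t); rewrite /ball/= sub0r normrN => /(_ sd st0) /=.
rewrite subrK => H.
have -> : f s - f t - l * (s - t) = ((s - t)^-1 * (f s - f t) - l) * (s - t).
  by rewrite mulrBl mulrAC mulVf// mul1r.
by rewrite normrM distrC ler_wpM2r.
Qed.

End WithinDerivative.

(** * Functions with zero derivative outside a small set *)

Section ZeroDerivative.
Context {R : realType}.

(** Consider the supremum of the points of [0, b] at which [P] holds. The step carries [P] from a
    point y close to it either to b, which is the claim, or beyond the supremum, which is absurd.
    Since [P] may fail at the supremum itself, the step starts from some y at or below it. *)
Lemma real_induction (b : R) (P : R -> Prop) : 0 <= b -> P 0 ->
  (forall t, 0 <= t <= b -> exists2 d, 0 < d &
    forall y x, 0 <= y -> t - d < y -> y <= t -> t <= x -> x < t + d -> x <= b ->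
      P y -> P x) ->
  P b.
Proof.
move=> b0 P0 step.
pose S := [set x | 0 <= x <= b /\ P x].
have S0 : S 0 by split => //; rewrite lexx.
have hS : has_sup S by split; [exists 0|exists b => x [/andP[]]].
have s0 : 0 <= sup S by apply: (sup_upper_bound hS).
have sb : sup S <= b by apply: ge_sup => [|x [/andP[]]//]; exists 0.
have /step[d d0 Hd] : 0 <= sup S <= b by rewrite s0.
have [y [/andP[y0 yb] Py] yd] := sup_adherent d0 hS.
have ys : y <= sup S by apply: (sup_upper_bound hS); split=> //; rewrite y0.
have [sdb|bsd] := leP (sup S + d / 2) b; last first.
  have [lsb|] := ltP b (sup S + d); first exact: (Hd y).
  by move=> ?; exfalso; lra.
have : S (sup S + d / 2).
  split; first by rewrite sdb andbT; lra.
  by apply: (Hd y) => //; lra.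
by move=> /(sup_upper_bound hS) ?; exfalso; lra.
Qed.

(* A gauge argument: near t outside E the increments of f are at most e times
   the length; the intervals around points of E are collected in a disjoint
   family inside U, on which f varies by less than e. *)
Lemma zero_derivative_constant (T : R) (f : R -> R) (E : set R) :
  (forall t, 0 <= t <= T -> ~ E t -> has_derivative_within `[0, T] f t 0) ->
  (forall e, 0 < e -> exists U : set R, [/\ open U, E `<=` U &
     forall (n : nat) (l r : 'I_n -> R),
      (forall i, [/\ 0 <= l i, l i <= r i & r i <= T]) ->
      (forall i, `[l i, r i] `<=` U) ->
      trivIset [set: 'I_n] (fun i => `]l i, r i[%classic) ->
      \sum_(i < n) `|f (r i) - f (l i)| < e]) ->
  forall t, 0 <= t <= T -> f t = f 0.
Proof.
move=> df smallE b /andP[b0 bT].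
suff H e : 0 < e -> `|f b - f 0| <= e * b + e.
  apply/eqP; rewrite -subr_eq0 -normr_eq0 eq_le normr_ge0 andbT.
  apply/ler_addgt0Pr => e e0; rewrite add0r.
  have b1 : 0 < b + 1 by lra.
  (* The choice e / (b + 1) turns the bound e b + e into e. *)
  rewrite (le_trans (H (e / (b + 1)) _)) ?divr_gt0//.
  by rewrite -{2}[e / _]mulr1 -mulrDr divfK// gt_eqF.
move=> e0; have [U [oU EU smallU]] := smallE _ e0.
(* The invariant: the increment of f up to x is paid for by e x and by finitely many disjoint
   intervals inside U. Their right ends are at most x, so an interval that starts at x can be added
   and the family stays disjoint. *)
pose P (x : R) := exists (n : nat) (l r : 'I_n -> R),
  [/\ forall i, [/\ 0 <= l i, l i <= r i & r i <= x],
      forall i, `[l i, r i] `<=` U,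
      trivIset [set: 'I_n] (fun i => `]l i, r i[%classic) &
      `|f x - f 0| <= \sum_(i < n) `|f (r i) - f (l i)| + e * x].
suff [n [l [r [lr lrU tlr fb]]]] : P b.
  rewrite (le_trans fb)// addrC lerD2l ltW//; apply: smallU => // i.
  by have [? ? ?] := lr i; split => //; lra.
apply: real_induction => //.
  exists 0%N, (fun=> 0), (fun=> 0); split => [[]//|[]//|[]//|].
  by rewrite subrr normr0 big_ord0 mulr0 addr0.
move=> t /andP[t0 tb].
have tT : 0 <= t <= T by rewrite t0 (le_trans tb).
have [Et|nEt] := pselect (E t).
(* For t in E the whole interval [y, x] lies in U and joins the family as its member number 0. *)
- have /nbhs_ballP[d /= d0 Bd] : nbhs t U by apply: open_nbhs_nbhs; split => //; exact: EU.
  exists d => // y x y0 tdy yt tx xtd xb [n [l [r [lr lrU tlr fy]]]].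
  pose ext (w : 'I_n -> R) z (i : 'I_n.+1) := if unlift ord0 i is Some j then w j else z.
  exists n.+1, (ext l y), (ext r x); split.
  + move=> i; rewrite /ext; case: unliftP => [j _|_].
      by have [? ? ?] := lr j; split => //; lra.
    by split => //; lra.
  + move=> i; rewrite /ext; case: unliftP => [j _|_]; first exact: lrU.
    move=> z /=; rewrite in_itv/= => /andP[yz zx]; apply: Bd; rewrite /ball/=.
    by rewrite ltr_norml; apply/andP; split; lra.
  + move=> i j _ _; rewrite /ext.
    case: unliftP => [i' ->|->]; case: unliftP => [j' ->|->] //.
    * by move=> ne; congr lift; apply: tlr.
    * case=> z [] /=; rewrite !in_itv/= => /andP[_ zr] /andP[yz _].
      by have [_ _ ry] := lr i'; exfalso; lra.
    * case=> z [] /=; rewrite !in_itv/= => /andP[yz _] /andP[_ zr].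
      by have [_ _ ry] := lr j'; exfalso; lra.
  + rewrite big_ord_recl /ext unlift_none.
    under eq_bigr do rewrite liftK.
    have -> : f x - f 0 = (f x - f y) + (f y - f 0) by ring.
    rewrite (le_trans (ler_normD _ _))// -addrA lerD2l (le_trans fy)// lerD2l.
    by rewrite ler_pM2l//; lra.
(* For t outside E the family is kept. The derivative at t compares values with f t only, so the
   increment from y to x is split at t. *)
- have /has_derivative_withinP/(_ _ e0)[d d0 Hd] := df t tT nEt.
  exists d => // y x y0 tdy yt tx xtd xb [n [l [r [lr lrU tlr fy]]]].
  exists n, l, r; split => //.
    by move=> i; have [? ? ?] := lr i; split => //; lra.
  have fxt : `|f x - f t| <= e * (x - t).
    have := Hd x; rewrite /= in_itv/= mul0r subr0 ger0_norm; last lra.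
    by apply; [apply/andP; split|]; lra.
  have fty : `|f t - f y| <= e * (t - y).
    have := Hd y; rewrite /= in_itv/= mul0r subr0 (distrC y) (distrC (f y)).
    rewrite (ger0_norm (_ : 0 <= t - y)); last lra.
    by apply; [apply/andP; split|]; lra.
  have -> : f x - f 0 = (f x - f t) + ((f t - f y) + (f y - f 0)) by ring.
  rewrite (le_trans (ler_normD _ _))//.
  rewrite (le_trans (lerD fxt (ler_normD _ _)))// (le_trans (lerD (lexx _) (lerD fty fy)))//.
  by rewrite le_eqVlt; apply/orP; left; apply/eqP; ring.
Qed.

End ZeroDerivative.

(** * Absolute continuity *)

Section AbsoluteContinuity.
Context {R : realType}.
Notation mu := (@lebesgue_measure R).
Implicit Types (a b c : R) (f g : R -> R).

Lemma absolutely_continuous_eq a b f g : (forall t, a <= t <= b -> f t = g t) ->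
  absolutely_continuous a b f -> absolutely_continuous a b g.
Proof.
move=> fg acf e /acf[d d0 Hd]; exists d => // n l r lr tlr /(Hd _ _ _ lr tlr).
congr (_ < _); apply: eq_bigr => i _; have [al lri rb] := lr i.
by rewrite !fg ?al ?rb ?(le_trans al) ?(le_trans lri).
Qed.

(** A comparison criterion that serves sums, multiples and products alike: increments of h
    controlled by those of f and g inherit their smallness. *)
Lemma absolutely_continuous_dominated a b c f g h : 0 <= c ->
  absolutely_continuous a b f -> absolutely_continuous a b g ->
  (forall s t, a <= s -> s <= t -> t <= b ->
    `|h t - h s| <= c * (`|f t - f s| + `|g t - g s|)) ->
  absolutely_continuous a b h.
Proof.
move=> c0 acf acg hfg e e0.
(* Two sums share e, and c + 1 stays positive when c = 0. *)
have e'0 : 0 < e / (2 * (c + 1)) by rewrite divr_gt0//; lra.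
have [d1 d10 Hd1] := acf _ e'0; have [d2 d20 Hd2] := acg _ e'0.
exists (Num.min d1 d2); first by rewrite lt_min d10.
move=> n l r lr tlr; rewrite lt_min => /andP[s1 s2].
apply: (@le_lt_trans _ _ (\sum_(i < n) c * (`|f (r i) - f (l i)| + `|g (r i) - g (l i)|))).
  by apply: ler_sum => i _; have [? ? ?] := lr i; exact: hfg.
rewrite -mulr_sumr big_split/=.
have := Hd1 n l r lr tlr s1; have := Hd2 n l r lr tlr s2.
set F := \sum_(i < n) _; set G := \sum_(i < n) _ => Fe Ge.
have F0 : 0 <= F by apply: sumr_ge0.
have G0 : 0 <= G by apply: sumr_ge0.
rewrite (le_lt_trans (ler_wpM2r (addr_ge0 G0 F0) (_ : c <= c + 1)))//; first lra.
have c1 : 0 < c + 1 by lra.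
rewrite mulrC -ltr_pdivlMr//.
rewrite (_ : e / (c + 1) = e / (2 * (c + 1)) + e / (2 * (c + 1))); first exact: ltrD.
by field; rewrite gt_eqF.
Qed.

Lemma absolutely_continuous_lipschitz a b c f :
  (forall s t, a <= s -> s <= t -> t <= b -> `|f t - f s| <= c * (t - s)) ->
  absolutely_continuous a b f.
Proof.
move=> lipf e e0; have c1 : 0 < `|c| + 1 by rewrite ltr_wpDl.
exists (e / (`|c| + 1)) => [|n l r lr _ sd]; first by rewrite divr_gt0.
rewrite (@le_lt_trans _ _ (\sum_(i < n) (`|c| + 1) * (r i - l i)))//.
  apply: ler_sum => i _; have [? lri ?] := lr i.
  rewrite (le_trans (lipf _ _ _ _ _))// ler_wpM2r ?subr_ge0//.
  by rewrite (le_trans (ler_norm c))// lerDl.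
by rewrite -mulr_sumr mulrC -ltr_pdivlMr.
Qed.

Lemma absolutely_continuous_cst a b c : absolutely_continuous a b (fun=> c).
Proof.
by apply: (@absolutely_continuous_lipschitz _ _ 0) => s t _ _ _; rewrite subrr normr0 mul0r.
Qed.

Lemma absolutely_continuousD a b f g :
  absolutely_continuous a b f -> absolutely_continuous a b g ->
  absolutely_continuous a b (fun t => f t + g t).
Proof.
move=> acf acg; apply: (absolutely_continuous_dominated ler01 acf acg) => s t _ _ _.
by rewrite mul1r opprD addrACA ler_normD.
Qed.

Lemma absolutely_continuousZ a b c f :
  absolutely_continuous a b f -> absolutely_continuous a b (fun t => c * f t).
Proof.
move=> acf; apply: (absolutely_continuous_dominated (normr_ge0 c) acf acf) => s t _ _ _.
by rewrite -mulrBr normrM ler_wpM2l// lerDl.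
Qed.

Lemma absolutely_continuous_sum a b n (c : 'I_n -> R) (f : 'I_n -> R -> R) :
  (forall i, absolutely_continuous a b (f i)) ->
  absolutely_continuous a b (fun t => \sum_i c i * f i t).
Proof.
elim: n c f => [|n IH] c f acf.
  under [X in absolutely_continuous _ _ X]eq_fun do rewrite big_ord0.
  exact: absolutely_continuous_cst.
rewrite (_ : (fun t => _) = fun t => c ord0 * f ord0 t +
    \sum_(i < n) c (lift ord0 i) * f (lift ord0 i) t).
  have H1 := absolutely_continuousZ (c ord0) (acf ord0).
  have H2 := IH (fun i => c (lift ord0 i)) (fun i => f (lift ord0 i)) (fun i => acf _).
  exact: absolutely_continuousD H1 H2.
by apply/funext => t; rewrite big_ord_recl.
Qed.

(** Taken for a single interval and e = 1, absolute continuity lets f vary by at most 1 over lengths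
    below d; each induction step therefore raises the bound by at most 1. *)
Lemma absolutely_continuous_bounded T f : 0 <= T -> absolutely_continuous 0 T f ->
  exists2 K, 0 <= K & forall t, 0 <= t <= T -> `|f t| <= K.
Proof.
move=> T0 /(_ _ ltr01)[d d0 Hd].
have fd y x : 0 <= y -> y <= x -> x <= T -> x - y < d -> `|f x - f y| <= 1.
  move=> y0 yx xT xyd.
  have := Hd 1%N (fun=> y) (fun=> x); rewrite !big_ord1 => H; apply/ltW/H => //.
  by move=> i j _ _ _; rewrite !ord1.
apply: (@real_induction R T (fun b => exists2 K, 0 <= K &
  forall t, 0 <= t <= b -> `|f t| <= K)) => //.
  by exists `|f 0| => // t t0; have -> : t = 0 by lra.
(* Radius d / 2 on both sides of t gives x - y < d. *)
move=> t tT; exists (d / 2); first lra.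
move=> y x y0 ty yt tx xt xT [K K0 HK].
exists (K + 1) => [|s /andP[s0 sx]]; first lra.
have [sy|ys] := leP s y.
  by rewrite (le_trans (HK s _)) ?s0//; lra.
have -> : f s = f y + (f s - f y) by ring.
rewrite (le_trans (ler_normD _ _))// lerD//; first by rewrite HK// y0 lexx.
by apply: fd; lra.
Qed.

Lemma absolutely_continuousM T f g : 0 <= T ->
  absolutely_continuous 0 T f -> absolutely_continuous 0 T g ->
  absolutely_continuous 0 T (fun t => f t * g t).
Proof.
move=> T0 acf acg.
have [K K0 fK] := absolutely_continuous_bounded T0 acf.
have [L L0 gL] := absolutely_continuous_bounded T0 acg.
apply: (absolutely_continuous_dominated (addr_ge0 K0 L0) acf acg) => s t s0 st tT.
have -> : f t * g t - f s * g s = f t * (g t - g s) + g s * (f t - f s) by ring.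
have {}fK : `|f t| <= K by apply: fK; rewrite tT andbT; lra.
have {}gL : `|g s| <= L by apply: gL; rewrite s0/=; lra.
rewrite (le_trans (ler_normD _ _))// !normrM.
rewrite (le_trans (lerD (ler_wpM2r _ fK) (ler_wpM2r _ gL)))//.
have := mulr_ge0 K0 (normr_ge0 (f t - f s)).
have := mulr_ge0 L0 (normr_ge0 (g t - g s)).
rewrite mulrDl !mulrDr; lra.
Qed.

Lemma absolutely_continuous_expR T c : absolutely_continuous 0 T (fun t => expR (c * t)).
Proof.
apply: (@absolutely_continuous_lipschitz _ _ (expR (`|c| * T) * `|c|)) => s t s0 st tT.
have bnd (r : R) : 0 <= r -> r <= T -> expR (c * r) <= expR (`|c| * T).
  move=> r0 rT; rewrite ler_expR (le_trans (ler_norm _))// normrM.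
  by rewrite (ger0_norm r0) ler_wpM2l.
(* This is the tangent inequality 1 + (y - x) <= e^(y - x), multiplied by e^x. *)
have lip (x y : R) : expR x - expR y <= expR x * (x - y).
  have := expR_ge1Dx (y - x); rewrite -(ler_pM2l (expR_gt0 x)).
  by rewrite -expRD subrKC; lra.
have ts : `|c * t - c * s| = `|c| * (t - s).
  by rewrite -mulrBr normrM (ger0_norm (_ : 0 <= t - s))// subr_ge0.
have lip' (x y r : R) : 0 <= r -> r <= T -> x = c * r ->
    expR x - expR y <= expR (`|c| * T) * `|x - y|.
  move=> r0 rT ->; rewrite (le_trans (lip _ _))//.
  rewrite (le_trans (ler_wpM2l (expR_ge0 _) (ler_norm _)))// ler_wpM2r//.
  exact: bnd.
rewrite -mulrA -ts ler_norml; apply/andP; split.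
  by rewrite lerNl opprB distrC; apply: (lip' _ _ s) => //; lra.
by apply: (lip' _ _ t) => //; lra.
Qed.

Lemma sum_disjoint_le_measure n (l r : 'I_n -> R) (U : set R) :
  measurable U -> (forall i, l i <= r i) ->
  trivIset [set: 'I_n] (fun i => `]l i, r i[%classic) ->
  (forall i, `]l i, r i[ `<=` U) ->
  ((\sum_(i < n) (r i - l i))%:E <= mu U)%E.
Proof.
move=> mU lr tlr lrU; rewrite -sumEFin.
rewrite (eq_bigr (fun i => mu `]l i, r i[%classic)); last first.
  move=> i _; rewrite lebesgue_measure_itv/= lte_fin.
  case: ifPn => [//|]; rewrite -leNgt => rl.
  by congr EFin; apply/eqP; rewrite subr_eq0 eq_le rl lr.
rewrite -measure_bigsetU_ord//.
apply: le_measure; rewrite ?inE//.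
  by apply: bigsetU_measurable => i _.
by apply: (big_ind (fun A => A `<=` U)) => // A B AU BU; rewrite subUset.
Qed.

(** The exceptional null set has an open neighbourhood U of measure below d, by outer regularity,
    and an absolutely continuous function varies by less than e on disjoint intervals inside U. *)
Lemma absolutely_continuous_constant T f : absolutely_continuous 0 T f ->
  {ae mu, forall t, 0 <= t <= T -> has_derivative_within `[0, T] f t 0} ->
  forall t, 0 <= t <= T -> f t = f 0.
Proof.
move=> acf [N [mN N0 dN]].
refine (@zero_derivative_constant R T f N _ _).
  by move=> t tT; apply: contra_notP => H; apply: dN => /=; rewrite not_implyE.
move=> e /acf[d d0 Hd].
have Noo : (mu N < +oo)%E by rewrite [X in (X < _)%E]N0.
have [U [oU NU UNd]] := lebesgue_regularity_outer mN Noo d0.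
exists U; split => // n l r lr lrU tlr; apply: Hd => //; rewrite -lte_fin.
have mU : measurable U by exact: open_measurable.
apply: le_lt_trans (sum_disjoint_le_measure mU _ tlr _) _.
- by move=> i; have [] := lr i.
- by move=> i; apply: subset_trans (lrU i); exact: subset_itv_oo_cc.
have mUN : measurable (U `\` N) by exact: measurableD.
have disj : N `&` (U `\` N) = set0 by rewrite setDE setICA setICr setI0.
by rewrite -(setDUK NU) (measureU mu mN mUN disj) [X in (X + _ < _)%E]N0 add0e.
Qed.

End AbsoluteContinuity.

(** * Duhamel's formula *)

Section IntegralFunction.
Context {R : realType}.
Notation mu := (@lebesgue_measure R).
Variables (T : R) (h : R -> R).
Hypothesis inth : mu.-integrable `[0, T] (EFin \o h).

Let I (t : R) : R := \int[mu]_(x in `[0, t]) h x.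

Let integrable_sub (A : set R) : measurable A -> A `<=` `[0, T] ->
  mu.-integrable A (EFin \o h).
Proof. by move=> mA AT; apply: integrableS inth. Qed.

Lemma integral_function_increment l r : 0 <= l -> l <= r -> r <= T ->
  I r - I l = \int[mu]_(x in `]l, r]) h x.
Proof.
move=> l0 lr rT; apply: Rintegral_itvB => //.
by apply: integrable_sub => // x /=; rewrite !in_itv/= => /andP[->] /le_trans ->.
Qed.

(** The integral of |h| over a set is small as soon as the measure of the set is small; this is
    applied to the union of the intervals, with h extended by zero to the whole line. *)
Lemma absolutely_continuous_integral : absolutely_continuous 0 T I.
Proof.
move=> e e0; pose f := h \_ `[0, T].
have intf : mu.-integrable setT (EFin \o f).
  by have := inth; rewrite integrable_mkcond// restrict_EFin.
have [d [d0 Hd]] := integral_normr_continuous intf e0.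
exists d => // n l r lr tlr lrd.
pose U := \big[setU/set0]_(i < n) `]l i, r i[%classic.
have mU : measurable U by apply: bigsetU_measurable => i _.
have muU : (mu U < d%:E)%E.
  rewrite /U measure_bigsetU_ord//.
  rewrite (eq_bigr (fun i => (r i - l i)%:E)) ?sumEFin ?lte_fin// => i _.
  rewrite /= lebesgue_measure_itv/= lte_fin; case: ifPn => [//|].
  have [_ lri _] := lr i; rewrite -leNgt => rli.
  by congr EFin; apply/eqP; rewrite eq_sym subr_eq0 eq_le rli lri.
have intnf : mu.-integrable setT (EFin \o (fun x => `|f x|)) := integrable_abse intf.
have mnf : measurable_fun setT (fun x => `|f x|).
  by have /measurable_EFinP := measurable_int mu intnf.
have intU : mu.-integrable U (EFin \o (fun x => `|f x|)).
  exact: integrableS intnf.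
apply: le_lt_trans (Hd _ mU muU).
rewrite -lee_fin -sumEFin /Rintegral fineK; last first.
  by apply: integrable_fin_num; [exact: mU|exact: intU].
rewrite ge0_integral_bigsetU ?index_enum_uniq//=; last 2 first.
- exact: sub_trivIset tlr.
- by apply/measurable_EFinP; exact: measurable_funTS.
apply: lee_sum => i _; have [l0 lri rT] := lr i.
have sub : `]l i, r i] `<=` `[0, T].
  move=> x /=; rewrite !in_itv/= => /andP[lx xr].
  by rewrite (le_trans l0 (ltW lx)) (le_trans xr rT).
have inti : mu.-integrable `]l i, r i] (EFin \o h) by exact: integrable_sub.
rewrite integral_function_increment//.
have : `|\int[mu]_(x in `]l i, r i]) h x| <= \int[mu]_(x in `]l i, r i]) `|h x|.
  by apply: le_normr_Rintegral => //; exact: inti.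
rewrite -lee_fin => /le_trans; apply.
rewrite /Rintegral fineK; last first.
  by apply: integrable_fin_num => //; exact: integrable_abse inti.
(* Increments of [I] live on half-open intervals, the disjoint union is made of open ones; the right
   end point carries no mass. *)
rewrite -integral_itv_bndo_bndc; last first.
  have intoo : mu.-integrable `]l i, r i[ (EFin \o h).
    by apply: integrable_sub => // x xlr; apply: sub; exact: subset_itv_oo_oc xlr.
  exact: (measurable_int mu (integrable_abse intoo)).
rewrite le_eqVlt; apply/orP; left; apply/eqP.
apply: eq_integral => x; rewrite inE/= => xlr; rewrite /f patchE mem_set//.
by apply: sub; exact: subset_itv_oo_oc xlr.
Qed.

(** Lebesgue differentiation is applied to the extension of h by zero, whose integral from 0 agrees
    with [I] on [0, T]; a two-sided derivative is then also one relative to [0, T]. *)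
Lemma ae_has_derivative_within_integral :
  {ae mu, forall t, 0 <= t <= T -> has_derivative_within `[0, T] I t (h t)}.
Proof.
pose f := h \_ `[0, T].
have intf : mu.-integrable setT (EFin \o f).
  by have := inth; rewrite integrable_mkcond// restrict_EFin.
have intf' (y : R) : mu.-integrable [set` Interval (BLeft 0) (BRight y)] (EFin \o f).
  exact: integrableS intf.
have := FTC1 intf' (open_integrable_locally openT intf).
(* Differentiation is available to the right of the lower limit 0 only, so the point 0 joins the
   null set. *)
have ne0 : {ae mu, forall x : R, x != 0}.
  exists [set 0]; split => //; first exact: lebesgue_measure_set1.
  by move=> x /= /negP; rewrite negbK => /eqP.
apply: filterS2 ne0; first exact: (ae_filter_ringOfSetsType mu).
move=> x x0 FTC /andP[xge0 xT].
have [|dF F'] := FTC; first by rewrite lte_fin lt_neqAle eq_sym x0.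
have fE s : s \in `[0, T]%classic -> f s = h s by move=> sT; rewrite /f patchE sT.
rewrite -fE; last by rewrite inE/= in_itv/= xge0.
rewrite -F' derive1E.
apply: has_derivative_within_eq; last exact/is_derive_has_derivative_within/derivableP/dF.
  by rewrite /= in_itv/= xge0.
move=> s; rewrite /= in_itv/= => /andP[s0 sT]; apply: eq_Rintegral => y.
rewrite inE/= in_itv/= => /andP[y0 ys].
by rewrite fE// inE/= in_itv/= y0 (le_trans ys).
Qed.

(** The quantity estimated is the integral of h - c over ]l, r]. With c = h t and t one of the end
    points it yields the derivative of [I] at t from either side. *)
Lemma integral_function_linear_approx l r c e : 0 <= l -> l <= r -> r <= T ->
  (forall x, l < x <= r -> `|h x - c| <= e) ->
  `|I r - I l - c * (r - l)| <= e * (r - l).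
Proof.
move=> l0 lr rT hc; rewrite integral_function_increment//.
have inti : mu.-integrable `]l, r] (EFin \o h).
  apply: integrable_sub => // x /=; rewrite !in_itv/= => /andP[lx xr].
  by rewrite (le_trans l0 (ltW lx)) (le_trans xr rT).
have intc a : mu.-integrable `]l, r] (EFin \o (fun=> a)).
  apply: measurable_bounded_integrable => //.
    by rewrite /= lebesgue_measure_itv/=; case: ifP => _; rewrite ?ltry// -EFinB ltry.
  by exists `|a|; split => // M aM x _; exact: ltW.
have cstE a : \int[mu]_(x in `]l, r]) a = a * (r - l).
  rewrite Rintegral_cst//= lebesgue_measure_itv/= lte_fin; case: ifPn => [_ //|].
  by rewrite -leNgt => rl; have -> : r - l = 0 by lra.
have intB : mu.-integrable `]l, r] (EFin \o (fun x => h x - c)).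
  by apply: (integrableB _ inti (intc c)).
rewrite -!cstE -RintegralB//.
apply: (@le_trans _ _ (\int[mu]_(x in `]l, r]) `|h x - c|)).
  by apply: le_normr_Rintegral => //; exact: intB.
by apply: le_Rintegral => //; exact: integrable_abse intB.
Qed.

Lemma has_derivative_within_integral t : {within `[0, T], continuous h} ->
  0 <= t <= T -> has_derivative_within `[0, T] I t (h t).
Proof.
move=> /subspace_continuousP ch /andP[t0 tT].
have tin : `[0, T]%classic t by rewrite /= in_itv/= t0.
apply/has_derivative_withinP => e e0.
have /cvgrPdist_le/(_ _ e0)/nbhs_ballP[d /= d0 Bd] := ch t tin.
have hd s : 0 <= s <= T -> `|s - t| < d -> `|h s - h t| <= e.
  by move=> s0 st; rewrite distrC; apply: Bd; rewrite /ball/= 1?distrC ?in_itv.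
exists d => // s; rewrite /= in_itv/= => /andP[s0 sT] sd.
have [ts|st] := leP t s.
  rewrite (ger0_norm (_ : 0 <= s - t)); last by lra.
  apply: integral_function_linear_approx => // x /andP[tx xs].
  apply: hd; first by apply/andP; split; lra.
  apply: le_lt_trans sd; rewrite !ger0_norm; lra.
rewrite (ltr0_norm (_ : s - t < 0)); last by lra.
rewrite opprB.
have -> : I s - I t - h t * (s - t) = - (I t - I s - h t * (t - s)) by ring.
rewrite normrN; apply: integral_function_linear_approx => //; first lra.
move=> x /andP[sx xt]; apply: hd; first by apply/andP; split; lra.
by apply: le_lt_trans sd; rewrite !ler0_norm; lra.
Qed.

End IntegralFunction.

(** * The scalar equation z' = a z + c u *)

Section ScalarEquation.
Context {R : realType}.
Notation mu := (@lebesgue_measure R).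
Variables (T : R) (u : R -> R) (a c z0 : R).
Hypothesis (T0 : 0 <= T) (intu : mu.-integrable `[0, T] (EFin \o u)).

Definition duhamel (t : R) : R := expR (a * t) * z0 +
  c * \int[mu]_(x in `[0, t]) (expR (a * (t - x)) * u x).

Let h (x : R) := expR (- a * x) * u x.
Let I (t : R) : R := \int[mu]_(x in `[0, t]) h x.

Let cexp (b : R) : continuous (fun x : R => expR (b * x)).
Proof.
move=> x; apply: continuous_comp; last exact: continuous_expR.
by apply: cvgMr; exact: cvg_id.
Qed.

Let inth : mu.-integrable `[0, T] (EFin \o h).
Proof.
apply: (@integrableMr _ _ _ mu `[0, T]%classic _ (fun x => expR (- a * x)) (EFin \o u)) => //.
  apply: (@measurable_funS _ _ _ _ setT) => //; apply: continuous_measurable_fun; exact: cexp.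
exists (expR (`|a| * T)); split => // M HM x; rewrite /= in_itv/= => /andP[x0 xT].
rewrite ger0_norm ?expR_ge0// ltW// (le_lt_trans _ HM)// ler_expR.
rewrite (le_trans (ler_norm _))// normrM normrN (ger0_norm x0) ler_wpM2l//.
Qed.

Let continuous_h : {within `[0, T], continuous u} -> {within `[0, T], continuous h}.
Proof.
have ce : {within `[0, T], continuous (fun x => expR (- a * x))}.
  by apply: continuous_subspaceT; exact: cexp.
by move=> cu x; apply: cvgM; [exact: ce|exact: cu].
Qed.

(** Pulling e^(a t) out of the integral leaves t in the upper limit only, so the product rule and
    the results on [I] apply. *)
Lemma duhamelE t : 0 <= t <= T -> duhamel t = expR (a * t) * (z0 + c * I t).
Proof.
move=> /andP[t0 tT]; rewrite /duhamel mulrDr mulrCA; congr (_ + c * _).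
have intht : mu.-integrable `[0, t] (EFin \o h).
  apply: integrableS inth => // x /=; rewrite !in_itv/= => /andP[-> /le_trans]; exact.
rewrite /I -RintegralZl//; apply: eq_Rintegral => x _.
by rewrite /h mulrA -expRD; congr (expR _ * _); ring.
Qed.

Lemma has_derivative_within_expR (b t : R) (D : set R) :
  has_derivative_within D (fun x => expR (b * x)) t (b * expR (b * t)).
Proof.
apply: is_derive_has_derivative_within.
have db : is_derive t 1 (b *: @id R) (b *: 1) by exact: is_deriveZ.
by have := is_derive1_comp (is_derive_expR (b * t)) db; rewrite mulrC /GRing.scale/= mulr1.
Qed.

Let duhamel_derivative t : 0 <= t <= T ->
  has_derivative_within `[0, T] I t (h t) ->
  has_derivative_within `[0, T] duhamel t (a * duhamel t + c * u t).
Proof.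
move=> tT dI.
have := has_derivative_withinM (@has_derivative_within_expR a t `[0, T]%classic)
  (has_derivative_withinD (@has_derivative_within_cst R `[0, T]%classic t z0)
    (has_derivative_withinZ (a := c) dI)).
have -> : expR (a * t) * (0 + c * h t) + a * expR (a * t) * (z0 + c * I t) =
    a * duhamel t + c * u t.
  rewrite duhamelE// /h add0r [expR _ * (c * _)]mulrCA [expR (a * t) * (_ * u t)]mulrA.
  by rewrite -expRD -mulrDl subrr mul0r expR0; ring.
apply: has_derivative_within_eq; first by rewrite /= in_itv.
by move=> s /=; rewrite in_itv/= => sT; rewrite duhamelE.
Qed.

(** Along a solution z the derivative of the integrating factor cancels the linear term a z, and the
    term with [I] cancels the forcing term. *)
Let homogenized (z : R -> R) (s : R) : R := expR (- a * s) * z s + - c * I s.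

Let homogenized_derivative (z : R -> R) t :
  has_derivative_within `[0, T] I t (h t) ->
  has_derivative_within `[0, T] z t (a * z t + c * u t) ->
  has_derivative_within `[0, T] (homogenized z) t 0.
Proof.
move=> dI dz.
have := has_derivative_withinD
  (has_derivative_withinM (@has_derivative_within_expR (- a) t `[0, T]%classic) dz)
  (has_derivative_withinZ (a := - c) dI).
congr has_derivative_within; rewrite /h; ring.
Qed.

Let I0 : I 0 = 0.
Proof. by rewrite /I set_itv1 Rintegral_set1. Qed.

Lemma duhamel0 : duhamel 0 = z0.
Proof. by rewrite /duhamel set_itv1 Rintegral_set1 !mulr0 addr0 expR0 mul1r. Qed.

Let homogenized_constant (z : R -> R) t : z 0 = z0 -> 0 <= t <= T ->
  homogenized z t = homogenized z 0 -> z t = duhamel t.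
Proof.
move=> z00 tT; rewrite /homogenized I0 !mulr0 expR0 mul1r addr0 z00 duhamelE// => <-.
rewrite (_ : _ + c * I t = expR (- a * t) * z t); last by ring.
by rewrite mulrA -expRD -mulrDl subrr mul0r expR0 mul1r.
Qed.

Lemma absolutely_continuous_duhamel : absolutely_continuous 0 T duhamel.
Proof.
have H1 := absolutely_continuousD (absolutely_continuous_cst 0 T z0)
  (absolutely_continuousZ c (absolutely_continuous_integral inth)).
have H2 := absolutely_continuousM T0 (absolutely_continuous_expR T a) H1.
by apply: absolutely_continuous_eq H2 => t tT; rewrite duhamelE.
Qed.

Lemma ae_has_derivative_within_duhamel : {ae mu, forall t, 0 <= t <= T ->
  has_derivative_within `[0, T] duhamel t (a * duhamel t + c * u t)}.
Proof.
apply: filterS (ae_has_derivative_within_integral inth).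
  exact: (ae_filter_ringOfSetsType mu).
move=> t dI tT.
exact: duhamel_derivative (dI tT).
Qed.

Lemma has_derivative_within_duhamel t : {within `[0, T], continuous u} ->
  0 <= t <= T -> has_derivative_within `[0, T] duhamel t (a * duhamel t + c * u t).
Proof.
move=> cu tT; apply: duhamel_derivative => //.
apply: has_derivative_within_integral => //.
exact: continuous_h.
Qed.

Lemma absolutely_continuous_duhamel_unique (z : R -> R) : z 0 = z0 ->
  absolutely_continuous 0 T z ->
  {ae mu, forall t, 0 <= t <= T -> has_derivative_within `[0, T] z t (a * z t + c * u t)} ->
  forall t, 0 <= t <= T -> z t = duhamel t.
Proof.
move=> z00 acz dz t tT; apply: homogenized_constant => //.
apply: absolutely_continuous_constant tT.
  have H1 := absolutely_continuousM T0 (absolutely_continuous_expR T (- a)) acz.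
  exact: absolutely_continuousD H1
    (absolutely_continuousZ (- c) (absolutely_continuous_integral inth)).
apply: filterS2 (ae_has_derivative_within_integral inth) dz.
  exact: (ae_filter_ringOfSetsType mu).
move=> s dI dz sT.
exact: homogenized_derivative (dI sT) (dz sT).
Qed.

(** Here the derivative of [homogenized z] vanishes at every point, so the gauge argument runs with
    an empty exceptional set. *)
Lemma classical_duhamel_unique (z : R -> R) : {within `[0, T], continuous u} ->
  z 0 = z0 ->
  (forall t, 0 <= t <= T -> has_derivative_within `[0, T] z t (a * z t + c * u t)) ->
  forall t, 0 <= t <= T -> z t = duhamel t.
Proof.
move=> cu z00 dz t tT; apply: homogenized_constant => //.
have ch := continuous_h cu.
apply: (@zero_derivative_constant _ T (homogenized z) set0) tT.
  move=> s sT _; apply: homogenized_derivative; last exact: dz.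
  exact: has_derivative_within_integral.
(* Even a degenerate closed interval contains its left end, so only the empty family lies inside the
   empty set. *)
move=> e e0; exists set0; split => //.
case=> [|n] l r lr lr0 _; first by rewrite big_ord0.
have [_ l_le_r _] := lr ord0.
by case: (lr0 ord0 (l ord0)); rewrite /= in_itv/= lexx.
Qed.

End ScalarEquation.

(** * The frequencies *)

Section Trigonometry.
Context {R : realType}.
Implicit Types (x a : R).

Lemma cos_addnpi x k : cos (x + k%:R * pi) = (-1) ^+ k * cos x.
Proof.
elim: k => [|k IH]; first by rewrite mul0r addr0 expr0 mul1r.
by rewrite -natr1 mulrDl mul1r addrA cosDpi IH exprS -mulrA mulN1r.
Qed.

Lemma tan_addnpi x k : tan (x + k%:R * pi) = tan x.
Proof.
elim: k => [|k IH]; first by rewrite mul0r addr0.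
by rewrite -natr1 mulrDl mul1r addrA tanDpi.
Qed.

(** The sum telescopes: 2 sin x cos((2 j + 1) x) = sin((2 j + 2) x) - sin(2 j x). *)
Lemma sum_cos_odd_multiples x n :
  2 * sin x * \sum_(j < n) cos ((2 * j%:R + 1) * x) = sin (2 * n%:R * x).
Proof.
elim: n => [|n IH]; first by rewrite big_ord0 !mulr0 mul0r sin0.
rewrite big_ord_recr /= mulrDr IH.
have -> : 2 * n%:R * x = (2 * n%:R + 1) * x - x by ring.
have -> : 2 * n.+1%:R * x = (2 * n%:R + 1) * x + x by rewrite -natr1; ring.
by rewrite sinB sinD; ring.
Qed.

Lemma cos_sq_half x : cos x ^+ 2 = (1 + cos (2 * x)) / 2.
Proof. by rewrite mulr_natl cos_mulr2n; field. Qed.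

Lemma tan_ge0_pihalf x : 0 <= x < pi / 2 -> 0 <= tan x.
Proof.
move=> /andP[x0 xpi]; have pi0 := pi_gt0 R.
by rewrite divr_ge0 ?sin_ge0_pi ?cos_ge0_pihalf//; apply/andP; split; lra.
Qed.

Lemma tan_gt0_pihalf x : 0 < x < pi / 2 -> 0 < tan x.
Proof.
move=> /andP[x0 xpi]; have pi0 := pi_gt0 R.
by rewrite divr_gt0 ?sin_gt0_pi ?cos_gt0_pihalf//; apply/andP; split; lra.
Qed.

End Trigonometry.

(** * Solutions of the tangent equation, branch by branch *)

Section Frequencies.
Context {R : realType} (m : nat) (beta0 beta1 : R).
Hypotheses (m_gt0 : (0 < m)%N) (beta0_ge0 : 0 <= beta0).

Let mR_gt0 : 0 < m%:R :> R. Proof. by rewrite ltr0n. Qed.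

(** Below m pi the slow factor tan(w / (2 m)) stays on its first branch, where it is nonnegative and
    increasing. *)
Lemma half_angle_bounds (w : R) : 0 <= w -> w < m%:R * pi -> 0 <= w / (2 * m%:R) < pi / 2.
Proof.
have pi0 := pi_gt0 R.
move=> w0 wm; rewrite divr_ge0 ?mulr_ge0// ?ltW//=.
by rewrite ltr_pdivrMr ?mulr_gt0//; lra.
Qed.

Lemma omega_solution_exists (k : 'I_m) : 0 < beta1 ->
  exists w, k%:R * pi <= w < k%:R * pi + pi / 2 /\ omega_solution m beta0 beta1 w.
Proof.
have pi0 := pi_gt0 R.
move=> b10; pose d x : R := x / (2 * m%:R).
pose a : R := k%:R * pi.
have a0 : 0 <= a by rewrite mulr_ge0// ltW.
have am : a + pi <= m%:R * pi.
  by rewrite /a -{2}[pi]mul1r -mulrDl natr1 ler_pM2r// ler_nat.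
(* The equation at x + a with denominators cleared, hence continuous across the pole at pi / 2. By
   periodicity of tan the shift a = k pi enters only the slow factor. *)
pose G x : R := 2 * m%:R * beta1 * (sin x * sin (d (x + a))) - beta0 * (cos x * cos (d (x + a))).
have cd : continuous (fun x => d (x + a)).
  move=> x; apply: cvgMl; apply: cvgD; [exact: cvg_id|exact: cvg_cst].
have cG : continuous G.
  move=> x; apply: cvgB; apply: cvgMr; apply: cvgM.
  - exact: continuous_sin.
  - by apply: continuous_comp; [exact: cd|exact: continuous_sin].
  - exact: continuous_cos.
  - by apply: continuous_comp; [exact: cd|exact: continuous_cos].
have G0 : G 0 <= 0.
  rewrite /G sin0 cos0 mul0r mulr0 sub0r mul1r oppr_le0 mulr_ge0// add0r.
  have /andP[? ?] := half_angle_bounds a0 (lt_le_trans (ltr_pwDr pi0 (lexx a)) am).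
  by apply: cos_ge0_pihalf; rewrite /d; apply/andP; split; lra.
(* The strict sign at pi / 2, due to beta1 > 0, keeps the zero of [G] off the pole of tan. *)
have Gpi : 0 < G (pi / 2).
  rewrite /G sin_pihalf cos_pihalf mul0r mulr0 subr0 mul1r mulr_gt0 ?mulr_gt0//.
  have ap0 : 0 <= pi / 2 + a by lra.
  have apm : pi / 2 + a < m%:R * pi by lra.
  have /andP[_ ?] := half_angle_bounds ap0 apm.
  apply: sin_gt0_pihalf; rewrite /d divr_gt0//=; first lra.
  by rewrite mulr_gt0.
have H0 : Num.min (G 0) (G (pi / 2)) <= 0 <= Num.max (G 0) (G (pi / 2)).
  by rewrite ge_min G0 le_max (ltW Gpi) orbT.
have pi20 : 0 <= pi / 2 :> R by lra.
have [x] := IVT pi20 (continuous_subspaceT cG) H0.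
rewrite in_itv/= => /andP[x0 xpi] Gx.
have {}xpi : x < pi / 2.
  rewrite lt_neqAle xpi andbT; apply: contraTneq Gpi => <-.
  by rewrite Gx ltxx.
exists (x + a); split; first by apply/andP; split; rewrite -/a; lra.
have /andP[d0 dpi] : 0 <= d (x + a) < pi / 2 by apply: half_angle_bounds; lra.
have cx : cos x != 0 by rewrite gt_eqF// cos_gt0_pihalf//; apply/andP; split; lra.
have cdx : cos (d (x + a)) != 0.
  by rewrite gt_eqF// cos_gt0_pihalf//; apply/andP; split; lra.
split => //; first by rewrite cos_addnpi mulf_neq0// signr_eq0.
rewrite tan_addnpi; apply/eqP; rewrite /tan -/(d (x + a)) mulf_div eqr_div ?mulf_neq0//.
- by rewrite -subr_eq0; apply/eqP; rewrite -[RHS]Gx /G; ring.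
- by rewrite gt_eqF.
- by rewrite gt_eqF.
Qed.

(** On the branch both tangent factors are nonnegative and strictly increasing, hence so is their
    product. *)
Lemma omega_solution_unique k w w' : 0 < beta1 ->
  k%:R * pi <= w < k%:R * pi + pi / 2 -> k%:R * pi <= w' < k%:R * pi + pi / 2 ->
  w < m%:R * pi -> w' < m%:R * pi ->
  omega_solution m beta0 beta1 w -> omega_solution m beta0 beta1 w' -> w = w'.
Proof.
have pi0 := pi_gt0 R.
move=> b10; wlog ww : w w' / w < w'.
  move=> wlog_lt kw kw' wm w'm sw sw'.
  have [ww|ww|//] := ltgtP w w'; first exact: wlog_lt.
  by apply/esym/wlog_lt.
set a := k%:R * pi; move=> /andP[aw wa] /andP[aw' w'a] wm w'm [_ _ sw] [_ _ sw'].
have a0 : 0 <= a by rewrite mulr_ge0// ltW.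
have /andP[d0 dpi] := half_angle_bounds (le_trans a0 aw) wm.
have /andP[d'0 d'pi] := half_angle_bounds (le_trans a0 aw') w'm.
have dd : w / (2 * m%:R) < w' / (2 * m%:R) by rewrite ltr_pM2r// invr_gt0 mulr_gt0.
have tw x : tan x = tan (x - a) by rewrite -[in LHS](subrK a x) tan_addnpi.
have : tan (w - a) * tan (w / (2 * m%:R)) < tan (w' - a) * tan (w' / (2 * m%:R)).
  apply: ltr_pM.
  - by apply: tan_ge0_pihalf; apply/andP; split; lra.
  - by apply: tan_ge0_pihalf; apply/andP; split; lra.
  - by rewrite ltr_tan ?in_itv/=; [lra|apply/andP; split; lra..].
  - by rewrite ltr_tan ?in_itv/= //; apply/andP; split; lra.
by rewrite -!tw sw sw' ltxx.
Qed.

(** Let k be the integer part of s / pi. On the second half of the period tan s is negative while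
    the slow factor is positive, against a nonnegative right-hand side; the midpoint is a pole. *)
Lemma omega_solution_itv s : 0 < beta1 -> 0 <= s -> s < m%:R * pi ->
  omega_solution m beta0 beta1 s ->
  exists k : 'I_m, k%:R * pi <= s < k%:R * pi + pi / 2.
Proof.
have pi0 := pi_gt0 R.
move=> b10 s0 sm [cs cds ss].
have sp0 : 0 <= s / pi by rewrite divr_ge0// ltW.
have /andP[] := Num.Theory.truncn_itv sp0; set k := Num.truncn _.
rewrite ler_pdivlMr// ltr_pdivrMr// => ks sk.
have km : (k < m)%N.
  by rewrite -(ltr_nat R) -(ltr_pM2r pi0) (le_lt_trans ks).
exists (Ordinal km); rewrite /= ks/= ltNge; apply/negP => sk2.
move: sk; rewrite -natr1 mulrDl mul1r => sk.
have [seq|sne] := eqVneq s (k%:R * pi + pi / 2).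
  by move: cs; rewrite seq addrC cos_addnpi cos_pihalf mulr0 eqxx.
have {sne}sk2 : k%:R * pi + pi / 2 < s by rewrite lt_neqAle eq_sym sne.
have kp0 : 0 <= k%:R * pi :> R by rewrite mulr_ge0// ltW.
have ts : tan s = - tan (pi + k%:R * pi - s).
  have -> : s = (s - k%:R * pi - pi) + k.+1%:R * pi by rewrite -natr1; ring.
  rewrite tan_addnpi -tanN; congr tan; rewrite -natr1; ring.
have t1 : 0 < tan (pi + k%:R * pi - s).
  by apply: tan_gt0_pihalf; apply/andP; split; lra.
have t2 : 0 < tan (s / (2 * m%:R)).
  have /andP[_ ?] := half_angle_bounds s0 sm.
  apply: tan_gt0_pihalf; rewrite divr_gt0//=; first lra.
  by rewrite mulr_gt0.
have : 0 <= tan s * tan (s / (2 * m%:R)).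
  by rewrite ss divr_ge0 ?mulr_ge0// ltW.
by rewrite ts mulNr oppr_ge0 leNgt mulr_gt0.
Qed.

(** One solution is taken from each of the m branches; any solution below m pi lies on some branch
    and is the one taken there. The bound m pi is recorded for a counting argument on [omega]. *)
Lemma first_nonneg_solutions_exists : 0 < beta1 ->
  exists2 w : 'I_m -> R, first_nonneg_solutions beta0 beta1 w &
    forall i, w i < m%:R * pi.
Proof.
have pi0 := pi_gt0 R.
move=> b10; have [w Hw] := choice (omega_solution_exists^~ b10).
have wm i : w i < m%:R * pi.
  have [/andP[_ wi] _] := Hw i; apply: (lt_le_trans wi).
  have : (i.+1%:R : R) * pi <= m%:R * pi by rewrite ler_pM2r// ler_nat.
  by rewrite -natr1 mulrDl mul1r; lra.
have w0 i : 0 <= w i.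
  by have [/andP[wi _] _] := Hw i; apply: le_trans wi; rewrite mulr_ge0// ltW.
exists w => //; split => [i j ij|i|s s0 ss].
- have [/andP[_ wi] _] := Hw i; have [/andP[wj _] _] := Hw j.
  have : (i.+1%:R : R) * pi <= j%:R * pi by rewrite ler_pM2r// ler_nat.
  by rewrite -natr1 mulrDl mul1r; lra.
- by split => //; have [] := Hw i.
- have [sm|ms] := ltP s (m%:R * pi); last by right => i; exact: lt_le_trans ms.
  have [k ks] := omega_solution_itv b10 s0 sm ss.
  have [kw sw] := Hw k.
  by left; exists k; exact: (omega_solution_unique b10 ks kw).
Qed.

Lemma omega_first_nonneg_solutions : 0 < beta1 ->
  first_nonneg_solutions beta0 beta1 (@omega R m beta0 beta1).
Proof.
move=> b10; rewrite /omega gt_eqF//.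
have [w Hw _] := first_nonneg_solutions_exists b10.
by apply: (getPex (P := [set w | first_nonneg_solutions beta0 beta1 w])); exists w.
Qed.

(** As [omega] comes from [get], the bound is obtained by counting. If [omega k] were at least m pi,
    minimality would place each of the m solutions constructed below m pi among the values of
    [omega]. The resulting injection of indices is onto, so it reaches k, a contradiction. *)
Lemma omega_lt_mpi (k : 'I_m) : 0 < beta1 -> @omega R m beta0 beta1 k < m%:R * pi.
Proof.
move=> b10; have [Oinc Osol Omin] := omega_first_nonneg_solutions b10.
have [w [winc wsol wmin] wm] := first_nonneg_solutions_exists b10.
rewrite ltNge; apply/negP => mk.
have ex j : exists i : 'I_m, w j = omega beta0 beta1 i.
  have [wj0 sj] := wsol j; have [[i wi]|/(_ k) wk] := Omin _ wj0 sj; first by exists i.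
  by have := lt_trans wk (wm j); rewrite ltNge mk.
have [phi Hphi] := choice ex.
have winj : injective w.
  move=> i j wij; apply/val_inj; have [ij|ij|//] := ltngtP i j.
    by have := winc _ _ ij; rewrite wij ltxx.
  by have := winc _ _ ij; rewrite wij ltxx.
have phi_inj : injective phi by move=> i j ij; apply: winj; rewrite !Hphi ij.
have := wm (invF phi_inj k); rewrite Hphi f_invF ltNge mk.
by [].
Qed.

End Frequencies.

(** * The eigenvectors of M *)

(** The index n may fall outside the range; this case accounts for the missing right neighbour in
    the last row of M. *)
Lemma sum_ord_pick (R : realType) m n (F : nat -> R) :
  \sum_(j < m) (n == j :> nat)%:R * F j = if (n < m)%N then F n else 0.
Proof.
case: ifP => [nm|nm].
  rewrite (bigD1 (Ordinal nm))//= eqxx mul1r big1 ?addr0// => j jn.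
  suff -> : (n == j) = false by rewrite mul0r.
  by apply: contra_neqF jn => /eqP nj; apply/val_inj; rewrite /= -nj.
rewrite big1// => j _; suff -> : (n == j) = false by rewrite mul0r.
by apply: contraFF nm => /eqP ->.
Qed.

Section Spectrum.
Context {R : realType} (m : nat) (beta0 beta1 : R).
Hypotheses (m_ge2 : (2 <= m)%N) (beta0_ge0 : 0 <= beta0) (beta1_ge0 : 0 <= beta1).
Hypothesis beta_neq0 : (beta0, beta1) <> (0, 0).
Implicit Types k : 'I_m.

Let m_gt0 : (0 < m)%N. Proof. exact: ltnW. Qed.
Let mR_gt0 : 0 < m%:R :> R. Proof. by rewrite ltr0n. Qed.
Let mR_neq0 : m%:R != 0 :> R. Proof. by rewrite gt_eqF. Qed.

Notation w := (@omega R m beta0 beta1).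
Notation lam := (@lambda R m beta0 beta1).
Notation vk := (@v R m beta0 beta1).

Let den_gt0 : 0 < 2 * beta1 + beta0 * xi m.
Proof.
have xi0 : 0 < xi m :> R by rewrite invr_gt0.
have [b1|b1] := eqVneq beta1 0; last first.
  have b1_gt0 : 0 < beta1 by rewrite lt_neqAle eq_sym b1.
  by rewrite ltr_pwDl ?mulr_gt0// mulr_ge0// ltW.
rewrite b1 mulr0 add0r mulr_gt0// lt_neqAle beta0_ge0 andbT eq_sym.
by apply/eqP => b0; apply: beta_neq0; rewrite b0 b1.
Qed.

Lemma omega_beta1_eq0 k : beta1 = 0 -> w k = pi / 2 + k%:R * pi.
Proof. by move=> b1; rewrite /omega b1 eqxx -natr1; field. Qed.

Lemma beta1_eq0Vgt0 : beta1 = 0 \/ 0 < beta1.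
Proof.
have [->|b1] := eqVneq beta1 0; first by left.
by right; rewrite lt_neqAle eq_sym b1.
Qed.

Lemma omega_lt (i j : 'I_m) : (i < j)%N -> w i < w j.
Proof.
case: beta1_eq0Vgt0 => [b1 ij|b1]; last first.
  by have [H _ _] := omega_first_nonneg_solutions m_gt0 beta0_ge0 b1; exact: H.
by rewrite !omega_beta1_eq0// ltrD2l ltr_pM2r ?pi_gt0// ltr_nat.
Qed.

Lemma omega_bounds k : 0 <= w k < m%:R * pi.
Proof.
have pi0 := pi_gt0 R.
case: beta1_eq0Vgt0 => [b1|b1]; last first.
  rewrite omega_lt_mpi// andbT.
  by have [_ /(_ k)[]] := omega_first_nonneg_solutions m_gt0 beta0_ge0 b1.
rewrite omega_beta1_eq0//.
have k0 : 0 <= k%:R * pi :> R by rewrite mulr_ge0// ltW.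
have : (k.+1%:R : R) * pi <= m%:R * pi by rewrite ler_pM2r// ler_nat.
by rewrite -natr1 mulrDl mul1r => ?; apply/andP; split; lra.
Qed.

Lemma omega_half_angle_bounds k : 0 <= w k / (2 * m%:R) < pi / 2.
Proof. by have /andP[w0 wm] := omega_bounds k; exact: half_angle_bounds. Qed.

(* The equation for the frequencies, cleared of its denominators; in this form
   it also covers beta1 = 0. *)
Lemma omega_boundary_condition k :
  2 * m%:R * beta1 * (sin (w k) * sin (w k / (2 * m%:R))) =
  beta0 * (cos (w k) * cos (w k / (2 * m%:R))).
Proof.
case: beta1_eq0Vgt0 => [b1|b1].
  by rewrite omega_beta1_eq0// b1 mulr0 mul0r cos_addnpi cos_pihalf mulr0 mul0r mulr0.
have [_ /(_ k)[_ [cw cd]] + _] := omega_first_nonneg_solutions m_gt0 beta0_ge0 b1.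
rewrite /tan mulf_div => /eqP; rewrite eqr_div ?mulf_neq0// ?(gt_eqF b1)//.
by move=> /eqP <-; ring.
Qed.

Lemma lambda_inj : injective lam.
Proof.
suff lt_lam (i j : 'I_m) : (i < j)%N -> lam j < lam i.
  move=> i j ij; apply/val_inj; have [/lt_lam|/lt_lam|//] := ltngtP i j;
  by rewrite ij ltxx.
move=> /omega_lt wij; rewrite /lambda ltrN2 ltr_pM2l ?mulr_gt0 ?exprn_gt0//.
have /andP[i0 ipi] := omega_half_angle_bounds i.
have /andP[j0 jpi] := omega_half_angle_bounds j.
rewrite ltrXn2r//; first by apply: sin_ge0_pi; apply/andP; split; lra.
by rewrite ltr_sin ?in_itv/= ?ltr_pM2r ?invr_gt0 ?mulr_gt0//; apply/andP; split; lra.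
Qed.

Lemma vE k (i : 'I_m) (j : 'I_1) :
  vk k i j = nu beta0 beta1 k * cos ((2 * i%:R + 1) * (w k / (2 * m%:R))).
Proof.
rewrite mxE /vcomp; congr (_ * cos _); rewrite -natr1; field.
exact: mR_neq0.
Qed.

Lemma Mmat_row (F : nat -> R) (i : 'I_m) : \sum_(j < m) Mmat m beta0 beta1 i j * F j =
  m%:R ^+ 2 * ((if i == 0%N :> nat then -1
                else if i.+1 == m then - theta m beta0 beta1 else -2) * F i
    + (if (i.+1 < m)%N then F i.+1 else 0) + (if (0 < i)%N then F i.-1 else 0)).
Proof.
set d := (X in X * F i).
(* The row is a sum of three Kronecker deltas. The factor [(0 < i)%N%:R] is essential because [0.-1]
   is 0 and would hit the diagonal again. *)
transitivity (m%:R ^+ 2 * \sum_(j < m) ((i == j :> nat)%:R * (d * F j)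
    + (i.+1 == j :> nat)%:R * F j + (0 < i)%N%:R * ((i.-1 == j :> nat)%:R * F j))).
  rewrite mulr_sumr; apply: eq_bigr => j _; rewrite !mxE /xi exprVn invrK -mulrA.
  congr (_ * _); have [<-|ij] := eqVneq i j.
    rewrite eqxx mul1r -/d (gtn_eqF (ltnSn i)) mul0r addr0.
    case: (nat_of_ord i) => [|n]; first by rewrite mul0r addr0.
    by rewrite /= (ltn_eqF (ltnSn n)) mul0r mulr0 addr0.
  have -> : (i == j :> nat) = false by apply/negbTE.
  rewrite mul0r add0r; case: (nat_of_ord i) => [|n]/=.
    by rewrite orbF; case: eqP => _; rewrite ?(mul1r, mul0r, addr0).
  rewrite mul1r eqSS; have [<-|nj] := eqVneq (nat_of_ord j) n.
    by rewrite orbT gtn_eqF// mul0r add0r.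
  by rewrite orbF; case: eqP => _; rewrite ?(mul1r, mul0r, addr0).
rewrite !big_split/= -mulr_sumr (sum_ord_pick m i (fun n => d * F n)).
rewrite !sum_ord_pick ltn_ord; congr (_ * (_ + _)).
case: i {d} => -[|i]/= im; first by rewrite mul0r.
by rewrite mul1r (ltnW im).
Qed.

(** Arguments of neighbouring components differ by 2 x, so this is the eigenvalue equation in an
    interior row; the first row is the case y = x. *)
Lemma cos_second_difference (x y : R) :
  cos (y - 2 * x) + cos (y + 2 * x) - 2 * cos y = - (4 * sin x ^+ 2) * cos y.
Proof. by rewrite cosB cosD mulr_natl cos_mulr2n cos2sin2; ring. Qed.

(** The ghost value one place beyond the last component is 2 - theta times that component. This
    turns the last row of M, with diagonal -theta, into an interior row, and it is equivalent to the
    cleared equation for the frequency. *)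
Lemma cos_boundary k (x := w k / (2 * m%:R)) :
  cos (w k + x) = (2 - theta m beta0 beta1) * cos (w k - x).
Proof.
have den0 : 2 * beta1 * m%:R + beta0 != 0.
  have := mulr_gt0 mR_gt0 den_gt0.
  rewrite (_ : m%:R * _ = 2 * beta1 * m%:R + beta0); first by move=> /gt_eqF ->.
  by rewrite /xi; field; exact: mR_neq0.
have bc := omega_boundary_condition k; rewrite -/x in bc.
apply: (mulfI den0).
have -> : (2 * beta1 * m%:R + beta0) * ((2 - theta m beta0 beta1) * cos (w k - x)) =
    (2 * beta1 * m%:R - beta0) * cos (w k - x).
  by rewrite /theta /xi; field; rewrite mR_neq0 den0.
rewrite cosB cosD; apply/eqP; rewrite -subr_eq0; apply/eqP.
transitivity (2 * (beta0 * (cos (w k) * cos x) - 2 * m%:R * beta1 * (sin (w k) * sin x))).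
  ring.
by rewrite bc subrr mulr0.
Qed.

Lemma Mmat_eigenvector k : Mmat m beta0 beta1 *m vk k = lam k *: vk k.
Proof.
apply/matrixP => i j; rewrite !mxE -/(vk k) -/(vcomp _ _ _ _).
set x := w k / (2 * m%:R).
pose F n := nu beta0 beta1 k * cos ((2 * n%:R + 1) * x).
rewrite (eq_bigr (fun j : 'I_m => Mmat m beta0 beta1 i j * F j)); last first.
  by move=> n _; rewrite vE.
have -> : vcomp beta0 beta1 k i.+1 = F i by have := vE k i ord0; rewrite mxE.
rewrite Mmat_row /lambda -/x.
have Fsec n : F n + F n.+2 - 2 * F n.+1 = - (4 * sin x ^+ 2) * F n.+1.
  have := cos_second_difference x ((2 * n.+1%:R + 1) * x).
  rewrite (_ : (_ - 2 * x) = (2 * n%:R + 1) * x); last by rewrite -natr1; ring.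
  rewrite (_ : (_ + 2 * x) = (2 * n.+2%:R + 1) * x); last first.
    by rewrite -[n.+2%:R]natr1; ring.
  by rewrite /F => H; rewrite [RHS]mulrCA -H; ring.
have -> : - (4 * m%:R ^+ 2 * sin x ^+ 2) * F i = m%:R ^+ 2 * (- (4 * sin x ^+ 2) * F i).
  by ring.
congr (_ * _); case: i => -[|i] im /=.
  rewrite m_ge2 addr0 mulN1r.
  (* First row: the ghost value to the left is cos(- x) = cos x, which changes the diagonal entry -2
     into -1. *)
  have := cos_second_difference x x.
  rewrite /F mulr0 add0r mul1r => H.
  rewrite [RHS]mulrCA -H (_ : x - 2 * x = - x); last ring.
  rewrite cosN (_ : x + 2 * x = (2 * 1 + 1) * x); last by ring.
  by ring.
have -> : (i.+2 == m) = ~~ (i.+2 < m)%N by rewrite -leqNgt eqn_leq im.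
case: (boolP (i.+2 < m)%N) => im2 /=; first by rewrite -Fsec; ring.
have mE : m = i.+2 by apply/eqP; rewrite eqn_leq im leqNgt im2.
rewrite -Fsec /F.
have wE : w k = 2 * m%:R * x by rewrite /x mulrC divfK// mulf_neq0.
have mRE : m%:R = i%:R + 2 :> R by rewrite mE -!natr1; ring.
(* Last row: here m = i + 2 and w = 2 m x, so the two arguments are w + x and w - x. *)
have -> : cos ((2 * i.+2%:R + 1) * x) =
    (2 - theta m beta0 beta1) * cos ((2 * i.+1%:R + 1) * x).
  have := cos_boundary k; rewrite -/x => H.
  rewrite (_ : _ * x = w k + x) ?H; last by rewrite wE mRE -!natr1; ring.
  by congr (_ * cos _); rewrite wE mRE -!natr1; ring.
by ring.
Qed.

Lemma Mmat_sym : (Mmat m beta0 beta1)^T = Mmat m beta0 beta1.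
Proof.
apply/matrixP => i j; rewrite !mxE; congr (_ * _); rewrite eq_sym.
by have [->//|ij] := eqVneq i j; rewrite orbC.
Qed.

Lemma v_transpose_Mmat k : (vk k)^T *m Mmat m beta0 beta1 = lam k *: (vk k)^T.
Proof. by rewrite -{1}Mmat_sym -trmx_mul Mmat_eigenvector linearZ. Qed.

Lemma v_orthogonal i j : i != j -> (vk i)^T *m vk j = 0.
Proof.
move=> ij; have : lam i *: ((vk i)^T *m vk j) = lam j *: ((vk i)^T *m vk j).
  by rewrite scalemxAl -v_transpose_Mmat -mulmxA Mmat_eigenvector scalemxAr.
move=> /eqP; rewrite -subr_eq0 -scalerBl scaler_eq0 subr_eq0.
by rewrite (inj_eq lambda_inj) (negbTE ij) => /eqP.
Qed.

(** The half-angle formula reduces the squares to cosines of odd multiples of w / m, whose sum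
    telescopes. At w = 0 all cosines are 1, which gives the limit value 2 m. *)
Lemma sum_cos_sq k (x := w k / (2 * m%:R)) :
  4 * \sum_(i < m) cos ((2 * i%:R + 1) * x) ^+ 2 = 2 * m%:R + sin_ratio m (w k).
Proof.
have S : 2 * sin (w k / m%:R) * \sum_(i < m) cos ((2 * i%:R + 1) * (w k / m%:R)) = sin (2 * w k).
  by rewrite sum_cos_odd_multiples; congr sin; field; exact: mR_neq0.
have -> : 4 * \sum_(i < m) cos ((2 * i%:R + 1) * x) ^+ 2 =
    2 * m%:R + 2 * \sum_(i < m) cos ((2 * i%:R + 1) * (w k / m%:R)).
  rewrite -[in 2 * m%:R](card_ord m) -sumr_const !mulr_sumr -big_split/=.
  apply: eq_bigr => i _; rewrite cos_sq_half.
  rewrite (_ : 2 * ((2 * i%:R + 1) * x) = (2 * i%:R + 1) * (w k / m%:R)); first by field.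
  by rewrite /x; field; exact: mR_neq0.
congr (_ + _); rewrite /sin_ratio; case: ifPn => [/eqP w0|w0].
  congr (_ * _); rewrite w0 mul0r.
  under eq_bigr do rewrite mulr0 cos0.
  by rewrite sumr_const card_ord.
have /andP[wge0 wlt] := omega_bounds k.
have s0 : sin (w k / m%:R) != 0.
  rewrite gt_eqF// sin_gt0_pi// ltr_pdivrMr// [pi * _]mulrC wlt andbT.
  by rewrite divr_gt0// lt_neqAle eq_sym w0.
by rewrite -S mulrAC mulfK.
Qed.

Lemma v_normalized k : (vk k)^T *m vk k = 1%:M.
Proof.
have /andP[x0 xpi] := omega_half_angle_bounds k.
have nrm := sum_cos_sq k.
(* The term i = 0 is the squared cosine of an angle in [0, pi/2[, hence positive, so the root in
   [nu] does not vanish. *)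
have S0 : 0 < \sum_(i < m) cos ((2 * i%:R + 1) * (w k / (2 * m%:R))) ^+ 2.
  rewrite (bigD1 (Ordinal m_gt0))//= ltr_pwDl//; last by apply: sumr_ge0 => ? _; exact: sqr_ge0.
  rewrite mulr0 add0r mul1r exprn_gt0// cos_gt0_pihalf//.
  by have pi0 := pi_gt0 R; apply/andP; split; lra.
apply/matrixP => i j; rewrite !ord1 !mxE eqxx.
under eq_bigr do rewrite mxE vE -expr2 exprMn.
rewrite -mulr_sumr /nu -nrm expr_div_n sqr_sqrtr; last by rewrite mulr_ge0// ltW.
set S := (X in 0 < X) in S0 *; have S_neq0 : S != 0 by rewrite gt_eqF.
by rewrite -[4 * _]/(4 * S) -[X in _ * X = _]/S mulr1n; field.
Qed.

Lemma v_expansion (y : 'cV[R]_m) : y = \sum_(k < m) ((vk k)^T *m y) ord0 ord0 *: vk k.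
Proof.
pose V : 'M[R]_m := \matrix_(i, k) vk k i ord0.
have VTV : V^T *m V = 1%:M.
  apply/matrixP => i j; rewrite !mxE.
  rewrite (_ : \sum_(k < m) _ = ((vk i)^T *m vk j) ord0 ord0); last first.
    by rewrite !mxE; apply: eq_bigr => n _; rewrite !mxE.
  have [->|ij] := eqVneq i j; first by rewrite v_normalized mxE.
  by rewrite v_orthogonal// mxE.
(* For the square matrix [V] a left inverse is a right inverse: orthonormality of the columns
   already gives completeness. *)
rewrite -{1}[y]mul1mx -(mulmx1C VTV) -mulmxA; apply/matrixP => i j.
rewrite summxE mxE; apply: eq_bigr => k _; rewrite !mxE mulrC ord1; congr (_ * _).
by apply: eq_bigr => n _; rewrite !mxE.
Qed.

End Spectrum.

(** * Decoupling *)

Section EigenCoordinates.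
Context {R : realType} (m : nat) (beta0 beta1 : R).
Hypotheses (m_ge2 : (2 <= m)%N) (beta0_ge0 : 0 <= beta0) (beta1_ge0 : 0 <= beta1).
Hypothesis beta_neq0 : (beta0, beta1) <> (0, 0).
Variables (T g : R) (u : R -> R) (y0 : 'cV[R]_m).

Notation vk := (@v R m beta0 beta1).
Notation lam := (@lambda R m beta0 beta1).
Notation M := (Mmat m beta0 beta1).
Notation vkm k := (vcomp beta0 beta1 k m).

Definition eigencoord (y : 'cV[R]_m) (k : 'I_m) : R := ((vk k)^T *m y) ord0 ord0.

Lemma eigencoordE y k : eigencoord y k = \sum_i vk k i ord0 * y i ord0.
Proof. by rewrite /eigencoord mxE; apply: eq_bigr => i _; rewrite mxE. Qed.

Lemma eigencoord_Mmat y k : eigencoord (M *m y) k = lam k * eigencoord y k.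
Proof. by rewrite /eigencoord mulmxA v_transpose_Mmat// -scalemxAl mxE. Qed.

Lemma eigencoord_em a k : eigencoord (a *: em m) k = a * vkm k.
Proof.
have m0 : (0 < m)%N by exact: ltnW.
(* The entry 1 of [em] has the 0-based index m - 1, which is the 1-based index m of [vcomp]. *)
rewrite eigencoordE (bigD1 (Ordinal (_ : (m.-1 < m)%N)))/= ?prednK// => ltm.
rewrite !mxE /= prednK// eqxx mulr1 big1 ?addr0 1?mulrC// => i im.
rewrite [X in _ * X]mxE; suff -> : em m i ord0 = 0 :> R by rewrite !mulr0.
rewrite mxE; suff -> : (i.+1 == m) = false by [].
by apply: contra_neqF im => /eqP im; apply/val_inj; exact: (congr1 predn im).
Qed.

Lemma eigencoord_rhs y a k :
  eigencoord (M *m y + (g * a) *: em m) k = lam k * eigencoord y k + g * vkm k * a.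
Proof.
rewrite -eigencoord_Mmat mulrAC -eigencoord_em.
by rewrite /eigencoord mulmxDr mxE.
Qed.

Lemma eigencoord_ode_at (y : R -> 'cV[R]_m) t k :
  ode_at T M (fun t => (g * u t) *: em m) y t ->
  has_derivative_within `[0, T] (fun s => eigencoord (y s) k) t
    (lam k * eigencoord (y t) k + g * vkm k * u t).
Proof.
move=> dy; rewrite -eigencoord_rhs eigencoordE.
under [X in has_derivative_within _ X]eq_fun do rewrite eigencoordE.
exact: has_derivative_within_sum dy.
Qed.

(** By completeness of the eigenvectors every component of y is a fixed linear combination of the
    eigencoordinates, and so is every component of the right-hand side. *)
Lemma ode_at_eigencoord (y : R -> 'cV[R]_m) t : 0 <= t <= T ->
  (forall k, has_derivative_within `[0, T] (fun s => eigencoord (y s) k) t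
    (lam k * eigencoord (y t) k + g * vkm k * u t)) ->
  ode_at T M (fun t => (g * u t) *: em m) y t.
Proof.
move=> tT dc i.
have expand (z : 'cV[R]_m) : z i ord0 = \sum_k vk k i ord0 * eigencoord z k.
  rewrite {1}(v_expansion m_ge2 beta0_ge0 beta1_ge0 beta_neq0 z) summxE.
  by apply: eq_bigr => k _; rewrite mxE mulrC.
rewrite expand.
rewrite (eq_bigr (fun k => vk k i ord0 * (lam k * eigencoord (y t) k + g * vkm k * u t))).
  under [X in has_derivative_within _ X]eq_fun do rewrite expand.
  exact: has_derivative_within_sum.
by move=> k _; rewrite eigencoord_rhs.
Qed.

Hypotheses (T_ge0 : 0 <= T) (intu : (@lebesgue_measure R).-integrable `[0, T] (EFin \o u)).

Let sol (t : R) : 'cV[R]_m :=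
  \sum_k duhamel u (lam k) (g * vkm k) (eigencoord y0 k) t *: vk k.

Lemma eigencoord_sol t k :
  eigencoord (sol t) k = duhamel u (lam k) (g * vkm k) (eigencoord y0 k) t.
Proof.
rewrite /eigencoord /sol mulmx_sumr summxE (bigD1 k)//= big1 ?addr0 => [|j jk].
  by rewrite -scalemxAr v_normalized// mxE [X in _ * X]mxE eqxx mulr1.
by rewrite -scalemxAr v_orthogonal 1?eq_sym// scaler0 mxE.
Qed.

Lemma eq_sol (y : 'cV[R]_m) t :
  (forall k, eigencoord y k = duhamel u (lam k) (g * vkm k) (eigencoord y0 k) t) ->
  y = sol t.
Proof.
move=> yk; rewrite (v_expansion m_ge2 beta0_ge0 beta1_ge0 beta_neq0 y).
by apply: eq_bigr => k _; rewrite -yk.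
Qed.

Let zero_in : 0 <= (0 : R) <= T. Proof. by rewrite lexx T_ge0. Qed.

Lemma sol0 : sol 0 = y0.
Proof. by apply/esym/eq_sol => k; rewrite duhamel0. Qed.

Lemma caratheodory_solution_unique y :
  caratheodory_solution T M (fun t => (g * u t) *: em m) y0 y ->
  forall t, 0 <= t <= T -> y t = sol t.
Proof.
move=> [y00 acy dy] t tT; apply: eq_sol => k.
apply: (@absolutely_continuous_duhamel_unique R T u _ _ _ T_ge0 intu
  (fun s => eigencoord (y s) k)) tT; first by rewrite y00.
- apply: absolutely_continuous_eq (absolutely_continuous_sum (fun i => vk k i ord0) acy).
  by move=> s _; rewrite eigencoordE.
- apply: filterS dy; first exact: (ae_filter_ringOfSetsType lebesgue_measure).
  by move=> s dy sT; exact: eigencoord_ode_at (dy sT).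
Qed.

Lemma classical_solution_unique y : {within `[0, T], continuous u} ->
  classical_solution T M (fun t => (g * u t) *: em m) y0 y ->
  forall t, 0 <= t <= T -> y t = sol t.
Proof.
move=> cu [y00 dy] t tT; apply: eq_sol => k.
apply: (@classical_duhamel_unique R T u _ _ _ intu
  (fun s => eigencoord (y s) k)) tT => //; first by rewrite y00.
by move=> s sT; exact: eigencoord_ode_at (dy s sT).
Qed.

Lemma sol_ode_at (y : R -> 'cV[R]_m) t :
  (forall t, 0 <= t <= T -> y t = sol t) -> 0 <= t <= T ->
  (forall k, let d := duhamel u (lam k) (g * vkm k) (eigencoord y0 k) in
    has_derivative_within `[0, T] d t (lam k * d t + g * vkm k * u t)) ->
  ode_at T M (fun t => (g * u t) *: em m) y t.
Proof.
move=> ysol tT dd; apply: ode_at_eigencoord => // k.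
rewrite ysol// eigencoord_sol.
apply: has_derivative_within_eq (dd k); first by rewrite /= in_itv.
by move=> s; rewrite /= in_itv/= => sT; rewrite ysol// eigencoord_sol.
Qed.

Lemma caratheodory_solution_sol y : (forall t, 0 <= t <= T -> y t = sol t) ->
  caratheodory_solution T M (fun t => (g * u t) *: em m) y0 y.
Proof.
move=> ysol; split.
- by rewrite ysol// sol0.
- move=> i; apply: (@absolutely_continuous_eq _ _ _
    (fun t => \sum_k vk k i ord0 * duhamel u (lam k) (g * vkm k) (eigencoord y0 k) t)).
    by move=> t tT; rewrite ysol// summxE; apply: eq_bigr => k _; rewrite [RHS]mxE mulrC.
  by apply: absolutely_continuous_sum => k; exact: absolutely_continuous_duhamel.
- have dd k := ae_has_derivative_within_duhamel (lam k) (g * vkm k) (eigencoord y0 k) intu.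
  have aeF := ae_filter_ringOfSetsType (@lebesgue_measure R).
  (* The null sets of the finitely many coordinates are merged into one. *)
  apply: filterS (filter_forall aeF dd) => t {}dd tT.
  by apply: sol_ode_at => // k; exact: dd.
Qed.

Lemma classical_solution_sol y : {within `[0, T], continuous u} ->
  (forall t, 0 <= t <= T -> y t = sol t) ->
  classical_solution T M (fun t => (g * u t) *: em m) y0 y.
Proof.
move=> cu ysol; split; first by rewrite ysol// sol0.
move=> t tT; apply: sol_ode_at => // k.
exact: has_derivative_within_duhamel.
Qed.

End EigenCoordinates.

Unset Implicit Arguments.

Theorem lemma2p2 (R : realType) (m : nat) (T beta0 beta1 : R)
    (u Psi : R -> R) (hm : (2 <= m)%N) (hT : 0 < T)
    (hbeta0 : 0 <= beta0) (hbeta1 : 0 <= beta1)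
    (hbeta : (beta0, beta1) <> (0, 0))
    (hu : (@lebesgue_measure R).-integrable `[0, T] (EFin \o u)) :
  let M : 'M[R]_m := Mmat m beta0 beta1 in
  let g : R := gamma m beta0 beta1 in
  let psi0 : 'cV[R]_m := psi m Psi in
  let lam : 'I_m -> R := @lambda R m beta0 beta1 in
  let vk : 'I_m -> 'cV[R]_m := @v R m beta0 beta1 in
  let vkm : 'I_m -> R := fun k => vcomp beta0 beta1 k m in
  let f : R -> 'cV[R]_m := fun t => (g * u t) *: em m in
  let ysol : R -> 'cV[R]_m := fun t =>
    \sum_(k < m)
      (expR (lam k * t) * ((vk k)^T *m psi0) ord0 ord0
       + g * vkm k * \int[@lebesgue_measure R]_(tau in `[0, t])
                        (expR (lam k * (t - tau)) * u tau))
      *: vk k in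
  forall y : R -> 'cV[R]_m,
    (caratheodory_solution T M f psi0 y
      <-> forall t, 0 <= t <= T -> y t = ysol t)
    /\ ({within `[0, T], continuous u} ->
        (classical_solution T M f psi0 y
          <-> forall t, 0 <= t <= T -> y t = ysol t)).
Proof.
move=> M g psi0 lam vk vkm f ysol y; split=> [|cu]; split.
(* By unfolding, [ysol] is the sum of the [duhamel] terms with c = [g * vkm k] and initial value
   [eigencoord psi0 k]. *)
- exact: (caratheodory_solution_unique hm hbeta0 hbeta1 hbeta (ltW hT) hu).
- exact: (caratheodory_solution_sol hm hbeta0 hbeta1 hbeta (ltW hT) hu).
- exact: (classical_solution_unique hm hbeta0 hbeta1 hbeta hu cu).
- exact: (classical_solution_sol hm hbeta0 hbeta1 hbeta (ltW hT) hu cu).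
Qed.
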